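(* Suppose that every bridgeless graph $G$ admits a list $(E_0,E_1,E_2,E_3,E_4)$ of five even subgraphs such that every edge of $G$ belongs to exactly two of them and $|E_0|\geq \frac{3}{5}|E(G)|$. Then every bridgeless cubic graph $G$ satisfies $T(G)\leq \frac{|V(G)|}{10}$.
   Context: Graphs are finite and loopless but may have parallel edges. A cubic graph is one in which every vertex has degree $3$. An even subgraph is (the edge set of) a subgraph in which every vertex has even degree (possibly empty). For a cubic graph $G$ and $U\subseteq V(G)$, $G_U$ denotes the cubic graph obtained from $G$ by expanding every vertex of $U$ into a triangle: a vertex $v$ with incident edges $e_1,e_2,e_3$ is replaced by three new mutually adjacent vertices $v_1,v_2,v_3$, with $e_i$ now incident to $v_i$ instead of $v$. For a bridgeless cubic graph $G$, $T(G)$ is the minimum size of a set $U\subseteq V(G)$ such that the edge set of $G_U$ is the union of four (not necessarily distinct) perfect matchings of $G_U$. *)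

(* Defs.v *)
From HB Require Import structures.
From mathcomp Require Import all_boot all_order all_algebra.

Set Implicit Arguments.
Unset Strict Implicit.
Unset Printing Implicit Defensive.

(* Edges form a type of their own, so parallel edges are allowed; [ends_card]
   excludes loops. *)
Record mgraph := MGraph {
  vert : finType;
  edge : finType;
  ends : edge -> {set vert};
  ends_card : forall e : edge, #|ends e| = 2
}.

Section Basics.
Variable G : mgraph.

Definition incident (v : vert G) : {set edge G} := [set e | v \in ends e].

Definition degree_in (F : {set edge G}) (v : vert G) : nat :=
  #|F :&: incident v|.

Definition cubic : Prop := forall v : vert G, degree_in setT v = 3.

Definition even_subgraph (F : {set edge G}) : Prop :=
  forall v : vert G, ~~ odd (degree_in F v).

Definition perfect_matching (M : {set edge G}) : Prop :=
  forall v : vert G, degree_in M v = 1.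

Definition adjacent_in (F : {set edge G}) : rel (vert G) :=
  fun x y => [exists e in F, ends e == [set x; y]].

(* A bridge is an edge whose deletion separates its two ends. *)
Definition bridge (e : edge G) : Prop :=
  exists x y : vert G,
    ends e = [set x; y] /\ ~~ connect (adjacent_in (~: [set e])) x y.

Definition bridgeless : Prop := forall e : edge G, ~ bridge e.

Definition covered_by_four_perfect_matchings : Prop :=
  exists M : 'I_4 -> {set edge G},
    (forall i, perfect_matching (M i)) /\ \bigcup_i M i = [set: edge G].

End Basics.

(* The graph G_U. A vertex v outside U is kept as [inl v]; a vertex v in U is
   replaced by the vertices [inr (v, e)], one for each edge e at v, and e is
   attached to [inr (v, e)]. The new edges at v are the pairs S of distinct
   edges at v: the pair S = {e, f} joins [inr (v, e)] to [inr (v, f)]. When v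
   has degree 3 the new vertices and edges at v form a triangle. *)
Section Expansion.
Variables (G : mgraph) (U : {set vert G}).

Definition is_exp_vert (x : vert G + vert G * edge G) : bool :=
  match x with
  | inl v => v \notin U
  | inr (v, e) => (v \in U) && (v \in ends e)
  end.

Definition is_new_edge (p : vert G * {set edge G}) : bool :=
  [&& p.1 \in U, p.2 \subset incident p.1 & #|p.2| == 2].

Definition exp_vert : finType := {x : vert G + vert G * edge G | is_exp_vert x}.

Definition exp_edge : finType :=
  (edge G + {p : vert G * {set edge G} | is_new_edge p})%type.

Definition exp_ends (e : exp_edge) : {set exp_vert} :=
  match e with
  | inl f => [set x : exp_vert | match val x with
                                 | inl v => v \in ends f
                                 | inr (_, g) => g == f
                                 end]
  | inr p => [set x : exp_vert | match val x with
                                 | inl _ => false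
                                 | inr (v, g) => (v == (val p).1) &&
                                                 (g \in (val p).2)
                                 end]
  end.

Lemma exp_ends_card (e : exp_edge) : #|exp_ends e| = 2.
Proof.
case: e => [f | [[w S] /= /and3P [/= wU /subsetP Sw /eqP S2]]].
- pose p (x : exp_vert) := match val x with inl v => v | inr (v, _) => v end.
  rewrite -(ends_card f) -(@card_in_imset _ _ p) => [|x y].
    apply: eq_card => v; apply/imsetP/idP => [[x]|vf].
      rewrite inE /p => + ->; case: x => -[u|[u g]] /= xP //.
      by move/eqP<-; case/andP: xP.
    case vU: (v \in U).
      have xP : is_exp_vert (inr (v, f)) by rewrite /= vU.
      by exists (exist (fun x => is_exp_vert x) _ xP); rewrite ?inE /=.
    have xP : is_exp_vert (inl v) by rewrite /= vU.
    by exists (exist (fun x => is_exp_vert x) _ xP); rewrite ?inE /=.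
  rewrite !inE /p; case: x y => -[u|[u g]] xP [[v|[v h]] yP] /= xf yf uv.
  + by apply: val_inj; rewrite /= uv.
  + by case/andP: (yP) => vU _; case/negP: (xP); rewrite uv.
  + by case/andP: (xP) => uU _; case/negP: (yP); rewrite -uv.
  + by apply: val_inj; rewrite /= uv (eqP xf) (eqP yf).
- have yP g : g \in S -> is_exp_vert (inr (w, g)).
    by move=> gS; rewrite /= wU; have := Sw _ gS; rewrite inE.
  pose p (x : exp_vert) := match val x with inl _ => None | inr (_, g) => Some g end.
  have <- : #|[set Some g | g in S]| = 2 by rewrite card_imset // => ? ? [].
  rewrite -(@card_in_imset _ _ p) => [|x y].
    apply: eq_card => o; apply/imsetP/imsetP => [[x]|[g gS ->]].
      rewrite inE /p => + ->; case: x => -[//|[u g]] /= xP /andP [_ gS].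
      by exists g.
    by exists (exist (fun x => is_exp_vert x) _ (yP g gS)); rewrite ?inE /= ?eqxx.
  rewrite !inE /p; case: x y => -[//|[u g]] xP [[//|[v h]] vP] /=.
  by move=> /andP [/eqP uw _] /andP [/eqP vw _] [gh]; apply: val_inj; rewrite /= uw vw gh.
Qed.

Definition expand : mgraph := MGraph exp_ends_card.

End Expansion.

Lemma incident3 G : cubic G -> forall v : vert G, #|incident v| = 3.
Proof. by move=> c v; rewrite -(c v) /degree_in setTI. Qed.

Lemma expand_cubic G (U : {set vert G}) : cubic G -> cubic (expand U).
Proof.
move=> cG x; rewrite /degree_in setTI.
case: x => -[v|[v e]] xP.
  rewrite -(incident3 cG v).
  have inlI : injective (@inl (edge G) {p : vert G * {set edge G} | is_new_edge U p}) by move=> ? ? [].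
  rewrite -(card_imset (mem (incident v)) inlI).
  apply: eq_card => -[f|p]; rewrite !inE /=.
    by rewrite mem_imset // inE.
  by apply/esym/negbTE/imsetP => -[].
have /andP [vU ve] := xP.
pose h (f : edge G) : edge G + vert G * {set edge G} := if f == e then inl e else inr (v, [set e; f]).
pose k (y : edge (expand U)) : edge G + vert G * {set edge G} := match y with inl f => inl f | inr p => inr (val p) end.
have kI : injective k by move=> [a|a] [b|b] //= []; [move->|move/val_inj->].
have hI : injective h.
  move=> a b; rewrite /h; case: eqP => [->|ae]; case: eqP => [->|be] // [] /setP /(_ a).
  by rewrite !inE eqxx orbT; case: eqP => //= _ /esym /eqP.
rewrite -(incident3 cG v) -(card_imset _ hI) -(card_imset _ kI).
apply: eq_card => o; apply/imsetP/imsetP => -[].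
  move=> [f|[[w S] pP]]; rewrite !inE /=.
    by move=> /eqP <- ->; exists e; rewrite ?inE // /h eqxx.
  move=> /andP [/eqP ? eS] ->; subst w.
  have /and3P [_ /= /subsetP sS /eqP S2] := pP.
  have := cardsD1 e S; rewrite eS S2 => -[] /esym/eqP/cards1P [f Sf].
  have : f \in S :\ e by rewrite Sf inE.
  rewrite !inE => /andP [fe fS].
  exists f; first exact: sS.
  by rewrite /h (negbTE fe) -Sf setD1K.
move=> f fv ->; rewrite /h; case: eqP => [fe|/eqP fe].
  by exists (inl e); rewrite ?inE /=.
have pP : is_new_edge U (v, [set e; f]).
  rewrite /is_new_edge /= vU cards2 (eq_sym e f) fe andbT; apply/subsetP => z.
  by rewrite !inE => /orP [] /eqP -> //; rewrite inE in fv.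
by exists (inr (exist (fun p => is_new_edge U p) _ pP)); rewrite ?inE //= eqxx !inE eqxx.
Qed.

(* [is_T G t] says that T(G) = t. T is a relation because the minimum is taken
   over a family of sets U that is not known a priori to be nonempty. *)
Definition is_T (G : mgraph) (t : nat) : Prop :=
  (exists2 U : {set vert G},
     covered_by_four_perfect_matchings (expand U) & #|U| = t) /\
  (forall U : {set vert G},
     covered_by_four_perfect_matchings (expand U) -> t <= #|U|).

(* Main.v *)
(** At a vertex of a cubic graph, the three edges of a double cover by even
    subgraphs carry label pairs [ab], [bc], [ac] for three distinct indices
    [a], [b], [c]. Hence [E_0] is a disjoint union of circuits; as
    [|E_0| >= 3/5 |E(G)|], it misses at most a tenth of the vertices, and these
    form [U]. In [G_U] every new triangle is added to [E_0], its edge between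
    the edges labelled [ab] and [ac] receiving the label [0a]; the result is
    again a double cover by five even subgraphs, now with [E_0] spanning. For
    [i <> 0] the edges whose label contains both or neither of [0] and [i] form
    a perfect matching, and these four perfect matchings cover [G_U]. *)
Require Import Defs.
From mathcomp Require Import all_boot all_order all_algebra.
From mathcomp Require Import lra.
From Stdlib Require Import Classical.

Set Implicit Arguments.
Unset Strict Implicit.
Unset Printing Implicit Defensive.

(** Being covered by four perfect matchings is a mere [Prop], so the minimum defining $T(G)$ is
    reached by classical descent from one admissible set. *)
Lemma ex_least_value (T : Type) (P : T -> Prop) (f : T -> nat) (x : T) :
  P x -> exists2 y, P y & f y <= f x /\ forall z, P z -> f y <= f z.
Proof.
have [n] := ubnP (f x); elim: n x => // n IHn x le_fx Px.
have [[z [Pz lt_zx]]|no_less] := classic (exists z, P z /\ f z < f x).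
  have [|y Py [le_yz y_min]] := IHn z _ Pz; first exact: leq_trans lt_zx _.
  by exists y => //; split=> //; apply: leq_trans le_yz (ltnW lt_zx).
exists x => //; split=> // z Pz; rewrite leqNgt; apply/negP => lt_zx.
by apply: no_less; exists z.
Qed.

Lemma sum_degree_in (G : mgraph) (F : {set edge G}) :
  \sum_v degree_in F v = #|F| * 2.
Proof.
under eq_bigr => v _ do rewrite /degree_in -sum1_card.
rewrite (exchange_big_dep (mem F)) /= => [|v e _]; last by rewrite inE => /andP[].
rewrite -sum_nat_const; apply: eq_bigr => e eF.
rewrite -(ends_card e) -sum1_card; apply: eq_bigl => v.
by rewrite !inE eF.
Qed.

Lemma card_setI_triple (T : finType) (A : {set T}) (x y z : T) :
    x != y -> x != z -> y != z ->
  #|A :&: [set x; y; z]| = (x \in A) + (y \in A) + (z \in A).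
Proof.
move=> xy xz yz.
have -> : #|A :&: [set x; y; z]| = \sum_(t in [set x; y; z]) (t \in A).
  rewrite -sum1_card big_mkcond [RHS]big_mkcond; apply: eq_bigr => t _.
  by rewrite in_setI; case: (t \in A); case: (t \in _).
by rewrite -setUA big_setU1 ?inE ?negb_or ?xy // big_setU1 ?inE // big_set1 /= addnA.
Qed.

Lemma cards2_other (T : finType) (A : {set T}) (x : T) :
  #|A| = 2 -> x \in A -> exists2 y, y != x & A = [set x; y].
Proof.
move=> A2 xA; have := cardsD1 x A; rewrite A2 xA => -[] /esym/eqP/cards1P [y def_y].
have : y \in A :\ x by rewrite def_y set11.
by rewrite !inE => /andP [yx _]; exists y; rewrite // -def_y setD1K.
Qed.

Section CubicVertex.
Variables (G : mgraph) (cG : cubic G) (v : vert G).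

Lemma incident_third (x y : edge G) :
    x \in incident v -> y \in incident v -> x != y ->
  exists z, [/\ x != z, y != z & incident v = [set x; y; z]].
Proof.
move=> xv yv xy.
have Dv2 : #|incident v :\ x| = 2 by have := cardsD1 x (incident v); rewrite xv incident3 // => -[].
have yD : y \in incident v :\ x by rewrite in_setD1 eq_sym xy.
have [z zy def_D] := cards2_other Dv2 yD.
have : z \in incident v :\ x by rewrite def_D set22.
rewrite in_setD1 => /andP [zx _]; exists z; rewrite eq_sym zx eq_sym zy; split=> //.
by rewrite -setUA -def_D setD1K.
Qed.

Lemma incident_triple :
  exists x y z, [/\ x != y, x != z, y != z & incident v = [set x; y; z]].
Proof.
have /card_gt1P [x [y [xv yv xy]]] : 1 < #|incident v| by rewrite incident3.
by have [z [xz yz ->]] := incident_third xv yv xy; exists x, y, z.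
Qed.

Lemma even_degree_in (F : {set edge G}) :
  even_subgraph F -> degree_in F v = (degree_in F v != 0) * 2.
Proof.
move=> /(_ v); have : degree_in F v <= 3 by rewrite -(incident3 cG v) subset_leq_card ?subsetIr.
by case: (degree_in F v) => [|[|[|[|]]]].
Qed.

End CubicVertex.

(** An even degree at most 3 is 0 or 2, so [F] is 2-regular on the vertices it meets; the handshake
    sum concludes. *)
Lemma card_even_subgraph (G : mgraph) (F : {set edge G}) :
  cubic G -> even_subgraph F -> #|F| = #|[set v | degree_in F v != 0]|.
Proof.
move=> cG evF; apply/eqP; rewrite -(eqn_pmul2r (isT : 0 < 2)) -sum_degree_in.
rewrite -sum_nat_const big_mkcond [X in _ == X]big_mkcond; apply/eqP/eq_bigr => v _.
by rewrite inE {1}(even_degree_in cG v evF); case: eqP.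
Qed.

Section EvenDoubleCover.
Variables (G : mgraph) (cG : cubic G) (I : finType) (E : I -> {set edge G}).
Hypothesis evenE : forall i, even_subgraph (E i).
Hypothesis coverE : forall e, #|[set i | e \in E i]| = 2.

Lemma third_label (v : vert G) (x y z : edge G) (i : I) :
    x != y -> x != z -> y != z -> incident v = [set x; y; z] ->
  (z \in E i) = (x \in E i) (+) (y \in E i).
Proof.
move=> xy xz yz def_v; have := evenE i v; rewrite /degree_in def_v card_setI_triple //.
by do 3! case: (_ \in _).
Qed.

(* The label of the third edge is the symmetric difference of the labels of
   [x] and [y], and all three labels have size 2. *)
Lemma common_label (v : vert G) (x y : edge G) :
    x \in incident v -> y \in incident v -> x != y ->
  exists i, forall j, (x \in E j) && (y \in E j) = (j == i).
Proof.
move=> xv yv xy; have [z [xz yz def_v]] := incident_third cG xv yv xy.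
pose A e := [set i | e \in E i].
have Az : A z = (A x :\: A y) :|: (A y :\: A x).
  apply/setP => i; rewrite !inE (third_label i xy xz yz def_v).
  by case: (x \in _); case: (y \in _).
have : #|A z| = #|A x :\: A y| + #|A y :\: A x|.
  rewrite Az cardsU -[RHS]subn0; congr (_ - _); apply: eq_card0 => i.
  by rewrite !inE; case: (x \in _); case: (y \in _).
rewrite !cardsD (setIC (A y)) !coverE => cardAz.
(* With $k$ common labels, [cardAz] reads $2 = (2-k)+(2-k)$; under truncated subtraction too, only
   $k=1$ is possible. *)
have /cards1P [i def_i] : #|A x :&: A y| == 1 by move: cardAz; case: #|_| => [|[|[]]].
by exists i => j; have := in_set1 j i; rewrite -def_i !inE.
Qed.

Lemma common_label_uniq (v : vert G) (x y : edge G) (i j : I) :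
    x \in incident v -> y \in incident v -> x != y -> i != j ->
  ~~ [&& x \in E i, y \in E i, x \in E j & y \in E j].
Proof.
move=> xv yv xy /eqP ij; have [k Ek] := common_label xv yv xy.
by rewrite andbA !Ek; apply/andP => -[/eqP ik /eqP jk]; case: ij; rewrite ik jk.
Qed.

(** [E i] misses exactly one edge at [v]. If [E j] misses [v], that edge is the only agreement.
    Otherwise the two pairs of edges at [v] share exactly one edge, by [common_label_uniq], and the
    other two edges disagree. *)
Lemma agreeing_edge_uniq (v : vert G) (i j : I) :
    i != j -> degree_in (E i) v != 0 ->
  #|[set e in incident v | (e \in E i) == (e \in E j)]| = 1.
Proof.
move=> ij; have [x [y [z [xy xz yz def_v]]]] := incident_triple cG v.
have [xv yv zv] : [/\ x \in incident v, y \in incident v & z \in incident v].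
  by rewrite def_v !inE !eqxx !orbT.
rewrite setIdE setIC /degree_in def_v !card_setI_triple // !inE.
have := common_label_uniq xv yv xy ij.
have := common_label_uniq xv zv xz ij.
have := common_label_uniq yv zv yz ij.
rewrite !(third_label _ xy xz yz def_v).
by case: (x \in E i); case: (y \in E i); case: (x \in E j); case: (y \in E j).
Qed.

End EvenDoubleCover.

Section FourMatchings.
Variables (G : mgraph) (cG : cubic G) (E : 'I_5 -> {set edge G}).
Hypothesis evenE : forall i, even_subgraph (E i).
Hypothesis coverE : forall e, #|[set i | e \in E i]| = 2.

Let U := [set v | degree_in (E ord0) v == 0].

(** The label of a new edge $\{e,f\}$ consists of 0 and the common index of $e$ and $f$. As it
    contains 0, agreement of [i] with 0 means that both $e$ and $f$ lie in [E i]. *)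
Definition label_matching (i : 'I_5) : {set edge (expand U)} :=
  [set a : exp_edge U | match a with
                        | inl f => (f \in E ord0) == (f \in E i)
                        | inr p => (val p).2 \subset E i
                        end].

Lemma missed_edge (v : vert G) (e : edge G) :
  v \in U -> v \in ends e -> e \notin E ord0.
Proof.
rewrite inE cards_eq0 => /eqP/setP/(_ e); rewrite !inE => + ve.
by rewrite ve andbT => ->.
Qed.

Lemma label_matching_perfect (i : 'I_5) :
  ord0 != i -> perfect_matching (label_matching i).
Proof.
move=> i0 [[v|[v e]] xP]; rewrite /degree_in.
  have := xP; rewrite /= inE => v0; rewrite -(agreeing_edge_uniq cG evenE coverE i0 v0).
  have inlI : injective (@inl (edge G) {p : vert G * {set edge G} | is_new_edge U p}) by move=> ? ? [].
  rewrite -(card_imset _ inlI); apply: eq_card => -[f|p]; rewrite !inE /=.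
    by rewrite mem_imset // !inE andbC.
  by rewrite andbF; apply/esym/negbTE/imsetP => -[].
have /andP [vU ve] := xP; have e0 := missed_edge vU ve.
(* At a triangle corner, [e] is outside [E ord0]. If it is also outside [E i], it is itself the
   matching edge; otherwise the second edge [f] of [E i] at [v] gives the triangle edge
   $\{e,f\}$. *)
apply/eqP/cards1P; have [ei|ei] := boolP (e \in E i); last first.
  exists (inl e); apply/setP => -[f|[[w S] pP]]; rewrite !inE /=.
    rewrite (eq_sym e); have [->|fe] := eqVneq f e.
      by rewrite (negbTE e0) (negbTE ei) !eqxx.
    by rewrite andbF; apply/esym/eqP => -[/eqP]; rewrite (negbTE fe).
  apply/negbTE; rewrite negb_and; have [eS|] := boolP (e \in S); last by rewrite andbF orbT.
  by apply/orP; left; apply: contra ei => /subsetP ->.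
have deg2 : degree_in (E i) v = 2.
  rewrite (even_degree_in cG) // cards_eq0; case: eqP => // /setP/(_ e).
  by rewrite !inE ei ve.
have [|f fe def_f] := cards2_other (x := e) deg2; first by rewrite !inE ei.
have /setIP [fi fv] : f \in E i :&: incident v by rewrite def_f set22.
have pP : is_new_edge U (v, [set e; f]).
  by rewrite /is_new_edge /= vU -def_f subsetIr -/(degree_in (E i) v) deg2.
exists (inr (exist (fun p => is_new_edge U p) _ pP)).
apply/setP => -[g|[[w S] qP]]; rewrite !inE /=.
  rewrite (eq_sym e) andbC; case: eqP => //= ->.
  by rewrite (negbTE e0) ei.
apply/andP/eqP => [[Si /andP [/eqP vw eS]]|[-> ->]]; last first.
  by rewrite eqxx set21 -def_f subsetIl.
subst w; have /and3P [_ /= Sv /eqP S2] := qP.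
congr inr; apply: val_inj; congr (_, _); apply/eqP.
by rewrite -def_f eqEcard subsetI Si Sv -/(degree_in (E i) v) deg2 S2.
Qed.

Lemma label_matching_cover (a : edge (expand U)) :
  exists2 i, ord0 != i & a \in label_matching i.
Proof.
case: a => [f|[[v S] pP]].
  have [f0|f0] := boolP (f \in E ord0).
    have [|i i0 def_i] := cards2_other (x := ord0) (coverE f); first by rewrite inE.
    exists i; first by rewrite eq_sym.
    by have := set22 ord0 i; rewrite -def_i !inE f0 => ->.
  (* The two labels of [f] together with 0 make at most three of the five indices; any remaining
     index agrees with 0 on [f], both being absent. *)
  have : [set i | f \in E i] :|: [set ord0] != setT.
    apply: contraTneq isT => full; have := cardsU [set i | f \in E i] [set ord0].
    by rewrite full cardsT card_ord coverE cards1; case: #|_| => [|[|[|]]].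
  rewrite -subTset => /subsetPn [i _]; rewrite !inE negb_or => /andP [fi i0].
  by exists i; rewrite 1?eq_sym // inE (negbTE f0) (negbTE fi).
have /and3P [/= vU /subsetP Sv /eqP S2] := pP.
have /eqP/cards2P [e [f [ef def_S]]] := S2.
have ev : e \in incident v by apply: Sv; rewrite def_S set21.
have fv : f \in incident v by apply: Sv; rewrite def_S set22.
(* This common index is nonzero because [E ord0] misses [v]. *)
have [i Ei] := common_label cG evenE coverE ev fv ef.
have /andP [ei fi] : (e \in E i) && (f \in E i) by rewrite Ei.
exists i; last by rewrite inE /= def_S; apply/subsetP => g /set2P [] ->.
by apply: contraNneq (missed_edge vU _) => [->|]; [exact: ei | rewrite inE in ev].
Qed.

Lemma expand_missed_covered : covered_by_four_perfect_matchings (expand U).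
Proof.
exists (fun i => label_matching (lift ord0 i)); split=> [i|].
  exact/label_matching_perfect/neq_lift.
apply/setP => a; rewrite in_setT; apply/bigcupP.
have [i i0 ai] := label_matching_cover a.
by have [j ? _] := unlift_some i0; exists j; subst.
Qed.

End FourMatchings.

Import GRing.Theory Num.Theory.
Local Open Scope ring_scope.

Theorem theorem3p4 :
  (forall G : mgraph, bridgeless G ->
     exists E : 'I_5 -> {set edge G},
       [/\ forall i : 'I_5, even_subgraph (E i),
           forall e : edge G, #|[set i : 'I_5 | e \in E i]| = 2%N
         & (#|E ord0|%:R : rat) >= 3 / 5 * #|edge G|%:R]) ->
  forall G : mgraph, bridgeless G -> cubic G ->
    exists t : nat, is_T G t /\ (t%:R : rat) <= #|vert G|%:R / 10.
Proof.
move=> cdc G bG cG; have [E [evenE coverE large]] := cdc G bG.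
have [W covW [leW minW]] :=
  ex_least_value (P := fun W : {set vert G} => covered_by_four_perfect_matchings (expand W))
    (fun W => #|W|) (expand_missed_covered cG evenE coverE).
exists #|W|; split; first by split=> //; exists W.
move: leW; set U := [set v | _] => leW.
(* [E ord0] has as many edges as vertices it meets, and [U] is the set of the others. *)
have cardE0 : (#|E ord0| + #|U| = #|vert G|)%N.
  rewrite (card_even_subgraph cG (evenE ord0)) -(cardC U) addnC; congr (_ + _)%N.
  by apply: eq_card => v; rewrite !inE.
have cardE : (#|edge G| * 2 = #|vert G| * 3)%N.
  rewrite -cardsT -sum_degree_in -sum_nat_const.
  by apply: eq_bigr => v _; apply: cG.
(* Numerically, $|U| = |V|-|E_0| \le |V| - \frac35\cdot\frac32|V| = \frac1{10}|V|$. *)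
have := congr1 (fun n => n%:R : rat) cardE0.
have := congr1 (fun n => n%:R : rat) cardE.
move: leW large; rewrite -(ler_nat rat) /= !natrM natrD.
by lra.
Qed.
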